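(* Let $K$ be a field of characteristic $0$, let $\sigma$ be a field automorphism of $K$, and let $r,s\in K$ with $r\neq0$. Let $\Lambda=(\lambda_1,\ldots,\lambda_m)$ be a sequence of elements of $K$ and let $\tilde\Lambda=(\tilde\lambda_1,\ldots,\tilde\lambda_m)$ with $\tilde\lambda_i=r\sigma(\lambda_i)+s$ for all $i$. Let $M=(\mu_{i,j})$ be an $m\times(n+1)$ multiplicity matrix. There is a polynomial $f(x)\in K[x]$ such that $M=M_f(\Lambda)$ if and only if there is a polynomial $\tilde f(x)\in K[x]$ such that $M=M_{\tilde f}(\tilde\Lambda)$.
   Context: For a polynomial $f$ of degree $n$ and a sequence $\Lambda=(\lambda_1,\ldots,\lambda_m)$ of elements of $K$, the multiplicity matrix $M_f(\Lambda)$ is the $m\times(n+1)$ matrix (rows $i\in\{1,\ldots,m\}$, columns $j\in\{0,\ldots,n\}$) whose $(i,j)$ entry is the multiplicity of $\lambda_i$ as a zero of $f^{(j)}(x)$ (which is $0$ if $f^{(j)}(\lambda_i)\neq0$). An $m\times(n+1)$ multiplicity matrix is a matrix $(\mu_{i,j})$ of nonnegative integers (columns $j=0,\ldots,n$) such that each row satisfies $\mu_{i,n}=0$ and $\mu_{i,j}\ge1\Rightarrow\mu_{i,j+1}=\mu_{i,j}-1$, and $\sum_{i=1}^m\mu_{i,j}\le n-j$ for all $j$. *)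

(* Defs.v *)
From HB Require Import structures.
From mathcomp Require Export all_boot all_order all_algebra.

Set Implicit Arguments.
Unset Strict Implicit.
Unset Printing Implicit Defensive.

Import GRing.Theory.
Local Open Scope ring_scope.

(* Meaningful when f has degree n: otherwise the number of columns is not that
   of M_f(Lambda), and mup is a junk value on zero derivatives. The degree is
   imposed in [has_multiplicity_mx]. *)
Definition multiplicity_mx (K : fieldType) (m n : nat) (f : {poly K})
    (Lambda : m.-tuple K) : 'M[nat]_(m, n.+1) :=
  \matrix_(i < m, j < n.+1) mup (tnth Lambda i) f^`(j).

(* M = M_f(Lambda), where M having n + 1 columns includes deg f = n. *)
Definition has_multiplicity_mx (K : fieldType) (m n : nat) (f : {poly K})
    (Lambda : m.-tuple K) (M : 'M[nat]_(m, n.+1)) : Prop :=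
  size f = n.+1 /\ M = multiplicity_mx n f Lambda.

Definition is_multiplicity_matrix (m n : nat) (M : 'M[nat]_(m, n.+1)) : Prop :=
  [/\ forall i : 'I_m, M i ord_max = 0%N,
      forall (i : 'I_m) (j k : 'I_n.+1), k = j.+1 :> nat ->
        (1 <= M i j)%N -> M i k = (M i j - 1)%N
    & forall j : 'I_n.+1, (\sum_(i < m) M i j <= n - j)%N].

(* Main.v *)
Require Import Defs.
From mathcomp Require Import all_boot all_order all_algebra.

Set Implicit Arguments.
Unset Strict Implicit.
Unset Printing Implicit Defensive.

Import GRing.Theory.
Local Open Scope ring_scope.

(** Write [L = r X + s]. Divisibility by powers of [X - x], hence the
    multiplicity of a zero, is transported both by [p |-> map_poly sigma p]
    (which sends the zero [x] to [sigma x]) and by [p |-> p \Po L] (which sends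
    the zero [r x + s] to [x]). Both maps are bijections of [K[X]] preserving
    the degree and commuting with the derivations up to nonzero constants, so
    [map_poly sigma f = f' \Po L] matches the solutions [f] for [Lambda] with
    the solutions [f'] for [Lambda']. *)

Lemma mup0 (K : fieldType) (x : K) : mup x (0 : {poly K}) = 0%N.
Proof.
(* The maximum is taken in ['I_(size p).+1], which has a single element for [p = 0]. *)
by rewrite /mup; move: [arg max_(_ > _ | _) _]; rewrite size_poly0 => i; rewrite ord1.
Qed.

(** For [p != 0], [k <= mup x p] holds exactly when [('X - x%:P) ^+ k] divides [p], so these
    divisibilities determine the multiplicity. The zero polynomial has the default value 0. *)
Lemma eq_mup (K F : fieldType) (x : K) (y : F) (p : {poly K}) (q : {poly F}) :
    (p == 0) = (q == 0) ->
    (forall k, (('X - x%:P) ^+ k %| p) = (('X - y%:P) ^+ k %| q)) ->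
  mup x p = mup y q.
Proof.
move=> pq0 dvd_pq; have [p0|pN0] := eqVneq p 0.
  by move: pq0; rewrite p0 eqxx => /esym/eqP ->; rewrite !mup0.
have qN0 : q != 0 by rewrite -pq0.
apply/eqP; rewrite eqn_leq (mup_geq _ _ qN0) -dvd_pq -mup_geq // leqnn.
by rewrite mup_geq // dvd_pq -mup_geq // leqnn.
Qed.

Lemma mup_map_poly (K F : fieldType) (phi : {rmorphism K -> F}) (x : K)
    (p : {poly K}) :
  mup (phi x) (map_poly phi p) = mup x p.
Proof.
apply: eq_mup => [|k]; first by rewrite map_poly_eq0.
by rewrite -map_polyXsubC -rmorphXn dvdp_map.
Qed.

Lemma mupZ (K : fieldType) (x a : K) (p : {poly K}) :
  a != 0 -> mup x (a *: p) = mup x p.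
Proof.
move=> aN0; apply: eq_mup => [|k]; last by rewrite dvdpZr.
by rewrite scaler_eq0 (negPf aN0).
Qed.

Section AffineSubstitution.

Variables (K : fieldType) (a b : K).
Hypothesis aN0 : a != 0.

Let L : {poly K} := a *: 'X + b%:P.
Let L' : {poly K} := a^-1 *: ('X - b%:P).

Lemma size_affine_poly : size L = 2%N.
Proof. by rewrite /L -mul_polyC size_MXaddC polyC_eq0 (negPf aN0) size_polyC aN0. Qed.

Lemma affine_polyK (p : {poly K}) : (p \Po L) \Po L' = p.
Proof.
rewrite -comp_polyA /L comp_polyD comp_polyZ comp_polyX comp_polyC.
by rewrite /L' scalerA divff // scale1r subrK comp_polyXr.
Qed.

Lemma affine_polyKV (p : {poly K}) : (p \Po L') \Po L = p.
Proof.
rewrite -comp_polyA /L' comp_polyZ comp_polyB comp_polyX comp_polyC.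
by rewrite /L addrK scalerA mulVf // scale1r comp_polyXr.
Qed.

Lemma mup_comp_affine (x : K) (p : {poly K}) :
  mup x (p \Po L) = mup (a * x + b) p.
Proof.
apply: eq_mup => [|k]; first by rewrite comp_poly2_eq0 // size_affine_poly.
(* Substituting [L] in ['X - (a * x + b)%:P] gives [a *: ('X - x%:P)], and nonzero constants do not
   affect divisibility. *)
have -> : (('X - x%:P) ^+ k %| p \Po L)
        = (('X - (a * x + b)%:P) ^+ k \Po L %| p \Po L).
  have -> : ('X - (a * x + b)%:P) ^+ k \Po L = a ^+ k *: ('X - x%:P) ^+ k.
    rewrite rmorphXn /= comp_polyB comp_polyX comp_polyC -exprZn /L.
    by rewrite polyCD polyCM scalerBr mul_polyC opprD addrACA subrr addr0.
  by rewrite dvdpZl // expf_neq0.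
apply/idP/idP => [|/dvdp_comp_poly]; last exact.
(* Composition with the inverse [L'] undoes the substitution on both sides. *)
by move=> /(dvdp_comp_poly L'); rewrite !affine_polyK.
Qed.

(** By the chain rule, each derivation contributes a factor [a], the derivative of [L]. *)
Lemma derivn_comp_affine (p : {poly K}) (j : nat) :
  (p \Po L)^`(j) = a ^+ j *: (p^`(j) \Po L).
Proof.
elim: j => [|j IHj]; first by rewrite !derivn0 scale1r.
rewrite !derivnS IHj derivZ deriv_comp /L derivD derivZ derivX derivC addr0.
by rewrite -scalerAr mulr1 scalerA exprSr.
Qed.

Lemma has_multiplicity_mx_comp_affine (m n : nat) (p : {poly K})
    (Lambda Lambda' : m.-tuple K) (M : 'M[nat]_(m, n.+1)) :
    (forall i, tnth Lambda' i = a * tnth Lambda i + b) ->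
  has_multiplicity_mx (p \Po L) Lambda M <-> has_multiplicity_mx p Lambda' M.
Proof.
move=> Lambda'E; rewrite /has_multiplicity_mx (size_comp_poly2 _ size_affine_poly).
suff -> : multiplicity_mx n (p \Po L) Lambda = multiplicity_mx n p Lambda' by [].
apply/matrixP => i j; rewrite !mxE derivn_comp_affine mupZ ?expf_neq0 //.
by rewrite mup_comp_affine Lambda'E.
Qed.

End AffineSubstitution.

Lemma has_multiplicity_mx_map (K F : fieldType) (phi : {rmorphism K -> F})
    (m n : nat) (p : {poly K}) (Lambda : m.-tuple K) (M : 'M[nat]_(m, n.+1)) :
  has_multiplicity_mx (map_poly phi p) (map_tuple phi Lambda) M
  <-> has_multiplicity_mx p Lambda M.
Proof.
rewrite /has_multiplicity_mx size_map_poly.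
suff -> : multiplicity_mx n (map_poly phi p) (map_tuple phi Lambda)
        = multiplicity_mx n p Lambda by [].
by apply/matrixP => i j; rewrite !mxE tnth_map derivn_map mup_map_poly.
Qed.

Theorem theorem5 (K : fieldType) (charK0 : [pchar K] =i pred0)
    (sigma : {rmorphism K -> K}) (sigma_bij : bijective sigma)
    (r s : K) (r_neq0 : r != 0) (m n : nat)
    (Lambda Lambda' : m.-tuple K)
    (Lambda'E : forall i : 'I_m,
       tnth Lambda' i = r * sigma (tnth Lambda i) + s)
    (M : 'M[nat]_(m, n.+1)) (M_mult : is_multiplicity_matrix M) :
  (exists f : {poly K}, has_multiplicity_mx f Lambda M) <->
  (exists f' : {poly K}, has_multiplicity_mx f' Lambda' M).
Proof.
have compP (p : {poly K}) := @has_multiplicity_mx_comp_affine K r s r_neq0 m n p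
  (map_tuple sigma Lambda) Lambda' M.
have {}Lambda'E i : tnth Lambda' i = r * tnth (map_tuple sigma Lambda) i + s.
  by rewrite tnth_map.
split=> [[f fM]|[f' /compP-/(_ Lambda'E) f'M]].
  (* The witness solves [map_poly sigma f = f' \Po L] for [f']. *)
  exists (map_poly sigma f \Po (r^-1 *: ('X - s%:P))); apply/compP => //.
  by rewrite affine_polyKV //; apply/has_multiplicity_mx_map.
have [tau sigmaK tauK] := sigma_bij.
exists (map_poly tau (f' \Po (r *: 'X + s%:P))).
(* The inverse [tau] is given as a bare function, so the transport goes along the morphism [sigma],
   which cancels [tau] on coefficients. *)
apply/(has_multiplicity_mx_map sigma).
by rewrite -map_poly_comp map_poly_id // => c _ /=; rewrite tauK.
Qed.
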